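(* Let $G$ be a compact abelian group, let $t_1,\dots,t_r\in G\setminus\{0\}$ and $D=\{t_1,\dots,t_r\}$. Suppose the lattice $\Lambda=\{n\in\mathbb{Z}^r: n_1t_1+\cdots+n_rt_r=0\}$ has rank $1$, and let $m=(m_1,\dots,m_r)\in\mathbb{Z}^r$ be a generator of $\Lambda$. Then, with $\|m\|_{\ell^1}=\sum_{i=1}^r|m_i|$, $$\mathrm{Md}_G(D)=\frac{\lfloor \|m\|_{\ell^1}/2\rfloor}{\|m\|_{\ell^1}}.$$
   Context: $\mu$ denotes the Haar probability measure on the compact (Hausdorff) abelian group $G$. The Motzkin density is $\mathrm{Md}_G(D)=\sup\{\mu(A): A\subset G \text{ Borel},\ (A-A)\cap D=\emptyset\}$. *)

(* Defs.v *)
From HB Require Import structures.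
From mathcomp Require Import all_boot all_order all_algebra.
From mathcomp Require Import all_classical all_reals all_analysis.
Set Implicit Arguments. Unset Strict Implicit. Unset Printing Implicit Defensive.
Import Order.TTheory GRing.Theory Num.Theory.
Local Open Scope classical_set_scope.
Local Open Scope ring_scope.

Definition borel (G : topologicalZmodType) : Type := G.

Section borel_instance.
Variable G : topologicalZmodType.
HB.instance Definition _ := Choice.on (borel G).
HB.instance Definition _ := isPointed.Build (borel G) (0 : G).

Lemma borel_setC (A : set G) : <<s @open G >> A -> <<s @open G >> (~` A).
Proof. by move=> sGA; rewrite -setTD; exact: sigma_algebraCD. Qed.

HB.instance Definition _ := @isMeasurable.Build (sigma_display (@open G))
  (borel G) <<s @open G >> (@sigma_algebra0 _ setT (@open G)) borel_setC
  (@sigma_algebra_bigcup _ setT (@open G)).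
End borel_instance.

Definition haar_probability (R : realType) (G : topologicalZmodType)
    (mu : probability (borel G) R) : Prop :=
  [/\ (forall (x : G) (A : set G), measurable (A : set (borel G)) ->
         mu ((fun y => x + y) @` A) = mu A),
      (forall A : set G, measurable (A : set (borel G)) ->
         mu A = ereal_inf [set mu U | U in [set U : set G | open U /\ A `<=` U]]) &
      (forall U : set G, open U ->
         mu U = ereal_sup [set mu K | K in [set K : set G | compact K /\ K `<=` U]])].

Definition motzkin_density (R : realType) (G : topologicalZmodType)
    (mu : probability (borel G) R) (D : set G) : \bar R :=
  ereal_sup [set mu A | A in [set A : set G |
     measurable (A : set (borel G)) /\
     (forall a b, A a -> A b -> ~ D (a - b))]].

(* Main.v *)
Require Import Defs.
From HB Require Import structures.
From mathcomp Require Import all_boot all_order all_algebra.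
From mathcomp Require Import all_fingroup.
From mathcomp Require Import all_classical all_reals all_analysis.
From mathcomp Require Import finmap measurable_realfun ring lra zify.
Set Implicit Arguments.
Unset Strict Implicit.
Unset Printing Implicit Defensive.
Import Order.TTheory GRing.Theory Num.Theory.
Local Open Scope ring_scope.

(** Write [L] for the l1-norm of the generator [m].

    Upper bound: the relation [\sum_i m i * t i = 0] is a closed walk of [L]
    steps [+- t i]. No translate of this walk has two cyclically consecutive
    vertices in an admissible set [A], hence at most [L./2] of its vertices lie
    in [A]; integrating over the translates gives [L * mu A <= L./2].

    Lower bound: let [F N] be the image in [G] of the cube of side [2 N + 1]
    in Z^r. By compactness [G] has a finite Borel colouring that is injective on
    every translate of [F N.+1]. Given an ordering [p] of the colours, send [x]
    to the point of [x + F N.+1] with the least colour, discard [x] unless this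
    point lies in [x + F N], and keep [x] when the level of the displacement
    lies in a maximum independent set of the cycle Z/L; here the level
    [\sum_i sgn (m i) * n i] is well defined modulo [L] because it maps [m] to
    [L]. The kept points form an admissible set. Averaging over [p] and
    over the rotations of the cycle, its measure is at least
    [(L./2 / L) * (#|F N| / #|F N.+1|)] for some choice, and this ratio of
    cardinals gets arbitrarily close to 1 since [#|F N|] grows polynomially. *)

(** * Independent sets in cycles, random orderings and polynomial growth *)

Section combinatorics.

Lemma sum_ord_shift (L : nat) (f : nat -> nat) :
  f L = f 0%N -> (\sum_(j < L) f j.+1 = \sum_(j < L) f j)%N.
Proof.
move=> fL; apply: (@addnI (f 0%N)).
by rewrite -(big_ord_recl L (fun j => f j)) big_ord_recr/= fL addnC.
Qed.

(** Double counting: each cyclic edge has at most one marked end, while each marked vertex is an end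
    of two edges. *)
Lemma cyclic_independent_count (L : nat) (b : nat -> bool) :
  b L = b 0%N -> (forall j, (j < L)%N -> ~~ (b j && b j.+1)) ->
  (\sum_(j < L) b j <= L./2)%N.
Proof.
move=> bL indep; rewrite geq_half_double -addnn.
rewrite -{2}(@sum_ord_shift L (fun j => b j)) ?bL// -big_split/=.
rewrite -[leqRHS]card_ord -sum1_card; apply: leq_sum => j _.
by have := indep j (ltn_ord j); do 2 case: (b _).
Qed.

(* Precomposing with transpositions shows that every point of [S] is the
   minimiser of equally many permutations. *)
Lemma card_perm_argmin (K : nat) (S S0 : {set 'I_K}) : S0 \subset S ->
  (#|[set p : 'S_K | [exists a in S0, [forall b in S, p a <= p b]]]| * #|S| =
   #|S0| * K`!)%N.
Proof.
move=> S0S; pose M a (p : 'S_K) := [forall b in S, (p a <= p b)%N].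
(* Since [p] is injective its minimiser on [S] is unique, so the existential counts as a sum over
   candidates. *)
have cardM (T : {set 'I_K}) : T \subset S ->
    #|[set p : 'S_K | [exists a in T, M a p]]| =
    (\sum_(a in T) \sum_(p : 'S_K) M a p)%N.
  move=> TS; rewrite exchange_big -sum1dep_card big_mkcond/=.
  apply: eq_bigr => p _; case: ifP => [/exists_inP[a aT Ma]|/exists_inPn h].
    rewrite (bigD1 a)//= Ma big1 ?addn0// => b /andP[bT ba].
    apply/eqP; rewrite eqb0; apply/negP => Mb.
    move/negP: ba; apply; apply/eqP/(@perm_inj _ p)/val_inj/eqP.
    rewrite eqn_leq (implyP (forallP Ma b)) ?(implyP (forallP Mb a))//.
      by rewrite (fintype.subsetP TS).
    by rewrite (fintype.subsetP TS).
  by rewrite big1// => a aT; rewrite (negbTE (h a aT)).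
have eqM a b : a \in S -> b \in S ->
    (\sum_(p : 'S_K) M a p = \sum_(p : 'S_K) M b p)%N.
  move=> aS bS; rewrite [RHS](reindex_inj (mulgI (tperm a b))).
  apply: eq_bigr => p _; congr nat_of_bool.
  have tS c : c \in S -> tperm a b c \in S by case: tpermP => // ->.
  apply/forall_inP/forall_inP => h c cS.
    by rewrite !permM tpermR; apply: h; exact: tS.
  have := h _ (tS _ cS); rewrite !permM tpermR.
  by rewrite tpermK.
rewrite cardM//; have [->|[a aS]] := set_0Vmem S0.
  by rewrite big_set0 cards0.
have aS' := fintype.subsetP S0S _ aS.
under eq_bigr => b bS do rewrite (eqM b a (fintype.subsetP S0S _ bS) aS').
rewrite sum_nat_const -mulnA; congr muln.
(* With [T := S] every permutation is counted, which evaluates the common summand as [K!] divided by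
   [#|S|]. *)
have := cardM S (subxx _).
under eq_bigr => b bS do rewrite (eqM b a bS aS').
rewrite sum_nat_const mulnC => <-.
rewrite -card_Sn -cardsT; apply: eq_card => p; rewrite !inE.
apply/exists_inP.
exists [arg min_(i < a in S) p i]; case: arg_minnP => // i iS imin.
by apply/forall_inP.
Qed.

(** Bernoulli's inequality raised to the power [r.+1] beats degree [r]. The exponent [N] is
    [M.+1 * r.+1], for which [N.*2.+1] is at most [3 * r.+1 * M.+1]; this gives the constant [C]. *)
Lemma exp_gt_poly (R : realType) (r : nat) (rho : R) : 1 < rho ->
  exists N : nat, ((N.*2.+1) ^ r)%:R < rho ^+ N.
Proof.
move=> rho1.
have bern M : M%:R * (rho - 1) <= rho ^+ M.
  elim: M => [|M IH]; first by rewrite mul0r expr0.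
  rewrite exprS -natr1.
  have : 1 <= rho ^+ M by rewrite exprn_ege1// ltW.
  by nra.
pose C : R := ((3 * r.+1) ^ r)%:R.
pose d := rho - 1.
have d0 : 0 < d by rewrite subr_gt0.
have [M] : exists M : nat, C / d ^+ r.+1 < M.+1%:R.
  exists (Num.truncn (C / d ^+ r.+1)).
  by apply: truncnS_gt.
rewrite ltr_pdivrMr ?exprn_gt0// => CM.
exists (M.+1 * r.+1)%N; rewrite exprM.
apply: (@lt_le_trans _ _ ((M.+1%:R * d) ^+ r.+1)); last first.
  have rho0 : 0 <= rho by rewrite ltW// (lt_trans ltr01).
  by apply: lerXn2r; rewrite ?nnegrE ?mulr_ge0 ?exprn_ge0 ?bern// ltW.
rewrite exprMn exprSr -mulrA.
apply: (@le_lt_trans _ _ (M.+1%:R ^+ r * C)).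
  rewrite /C -natrX -natrM ler_nat -expnMn.
  have [->|r0] := posnP r; first by rewrite !expn0.
  by rewrite leq_exp2r//; lia.
by rewrite ltr_pM2l ?exprn_gt0.
Qed.

(** If [b < a] with [b] positive, iterating the hypothesis makes [f N] at least [(a / b) ^+ N],
    against its polynomial bound. *)
Lemma poly_growth_ratio (R : realType) (f : nat -> nat) (r : nat) (a b : R) :
  (0 < f 0)%N -> (forall N, f N <= (N.*2.+1) ^ r)%N -> 0 <= b ->
  (forall N, a * (f N)%:R <= b * (f N.+1)%:R) -> a <= b.
Proof.
move=> f0 fr b0 ab; rewrite leNgt; apply/negP => ba.
have [b_eq0|b_neq0] := eqVneq b 0.
  have := ab 0%N; rewrite b_eq0 mul0r pmulr_lle0 ?ltr0n//.
  by rewrite leNgt -b_eq0 ba.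
have bp : 0 < b by rewrite lt0r b_neq0.
have [|N] := @exp_gt_poly R r (a / b); first by rewrite ltr_pdivlMr ?mul1r.
rewrite ltNge => /negP; apply.
apply: (@le_trans _ _ (f N)%:R); last by rewrite ler_nat.
elim: N => [|N IH]; first by rewrite expr0 ler1n.
rewrite exprS mulrAC ler_pdivrMr// [leRHS]mulrC.
by apply: le_trans (ab N); rewrite ler_pM2l// (lt_trans bp).
Qed.

(* A maximum independent set of the [L]-cycle. *)
Definition alt_residue (L : nat) (z : int) : bool :=
  let k := `|(z %% L)%Z|%N in ~~ odd k && (k < L./2.*2)%N.

Lemma alt_residueD (L : nat) (z k : int) :
  alt_residue L (z + k * L) = alt_residue L z.
Proof. by rewrite /alt_residue addrC modzMDl. Qed.

(** An even residue below [L./2.*2] is at most [L - 2], so its successor does not wrap around and is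
    odd. For odd [L] the cut-off excludes [L - 1], which is even and adjacent to [0]. *)
Lemma alt_residue_indep (L : nat) (z : int) : (0 < L)%N ->
  alt_residue L z -> ~~ alt_residue L (z + 1).
Proof.
move=> L0; rewrite /alt_residue => /andP[ev lt].
have [k kE] : exists k : nat, (z %% L)%Z = k.
  by exists `|(z %% L)%Z|%N; rewrite gez0_abs// modz_ge0// -lt0n.
have -> : ((z + 1) %% L)%Z = (k + 1)%N.
  rewrite -modzDml kE -PoszD modz_small//.
  by move: ev lt; rewrite kE/=; lia.
by rewrite absz_nat; move: ev; rewrite kE/= addn1/= => ->.
Qed.

(** A sum over a full period does not depend on [z]; at [z = 0] it counts the even numbers below
    [L./2.*2]. *)
Lemma sum_alt_residue (L : nat) (z : int) : (0 < L)%N ->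
  (\sum_(c < L) alt_residue L (z + c) = L./2)%N.
Proof.
move=> L0.
have shift (u : int) : (\sum_(c < L) alt_residue L (u + 1 + c) =
                \sum_(c < L) alt_residue L (u + c))%N.
  rewrite -(@sum_ord_shift L (fun c => alt_residue L (u + c))).
    by apply: eq_bigr => c _; rewrite -addrA -PoszD add1n.
  by rewrite -[X in u + X]mul1r alt_residueD addr0.
have -> : (\sum_(c < L) alt_residue L (z + c) =
           \sum_(c < L) alt_residue L (0%:Z + c))%N.
  elim/int_rec: z => [//|n IH|n IH].
    by rewrite -IH -[RHS]shift -[in LHS]addn1.
  by rewrite -IH -[LHS]shift -[in LHS]addn1 PoszD opprD addrNK.
transitivity (\sum_(c < L) (~~ odd c && (c < L./2.*2)))%N.
  apply: eq_bigr => c _; rewrite /alt_residue add0r modz_small//=.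
  by rewrite ltz_nat ltn_ord.
rewrite -(big_mkord xpredT (fun c => (~~ odd c && (c < L./2.*2)%N) : nat)).
have le : (L./2.*2 <= L)%N by lia.
rewrite (@big_cat_nat _ _ _ L./2.*2)//= [X in (_ + X)%N]big_nat_cond.
rewrite [X in (_ + X)%N]big1 ?addn0.
  under eq_big_nat => c /andP[_ ->] do rewrite andbT.
  elim: (L./2) => [|h IH]; first by rewrite big_geq.
  by rewrite doubleS !big_nat_recr//= IH odd_double/= addn0 addn1.
by move=> c /andP[/andP[cL _] _]; rewrite ltnNge cL andbF.
Qed.

End combinatorics.

Local Open Scope classical_set_scope.

(** * Integration of pointwise counts *)

Section prob_count.
Context (R : realType) (d : measure_display) (T : measurableType d).
Variables (mu : probability T R) (I : finType) (A : I -> set T).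
Hypothesis mA : forall i, measurable (A i).

Lemma integral_count :
  (\int[mu]_x (\sum_(i : I) (\1_(A i) x)%:E) = \sum_(i : I) mu (A i))%E.
Proof.
rewrite ge0_integral_sum//; first last.
- by move=> i; apply/measurable_EFinP; exact: measurable_indic.
by apply: eq_bigr => i _; rewrite integral_indic// setIT.
Qed.

Lemma measurable_count :
  measurable_fun setT (fun x => \sum_(i : I) (\1_(A i) x)%:E : \bar R)%E.
Proof.
apply: emeasurable_sum => i.
by apply/measurable_EFinP; exact: measurable_indic.
Qed.

Lemma countE x : (\sum_(i : I) (\1_(A i) x)%:E =
  ((\sum_(i : I) (x \in A i))%N%:R : R)%:E)%E.
Proof. by rewrite natr_sum -sumEFin; apply: eq_bigr => i _; rewrite indicE. Qed.

Lemma sum_measure_le (k : nat) :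
  (forall x, (\sum_(i : I) (x \in A i) <= k)%N) ->
  (\sum_(i : I) mu (A i) <= (k%:R : R)%:E)%E.
Proof.
move=> h; rewrite -integral_count.
rewrite -[leRHS]mule1 -(@probability_setT _ _ _ mu) -integral_cst//.
apply: ge0_le_integral => //.
- by move=> x _; rewrite countE lee_fin.
- exact: measurable_count.
- by move=> x _; rewrite countE lee_fin ler_nat.
Qed.

Lemma sum_measure_ge (k : nat) :
  (forall x, (k <= \sum_(i : I) (x \in A i))%N) ->
  ((k%:R : R)%:E <= \sum_(i : I) mu (A i))%E.
Proof.
move=> h; rewrite -integral_count.
rewrite -[leLHS]mule1 -(@probability_setT _ _ _ mu) -integral_cst//.
apply: ge0_le_integral => //.
- by move=> x _; rewrite lee_fin.
- exact: measurable_count.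
- by move=> x _; rewrite countE lee_fin ler_nat.
Qed.

End prob_count.

(** * Translations and finite Borel colourings *)

Section translate.
Context (G : topologicalZmodType).

Lemma continuous_addr (g : G) : continuous (fun x : G => x + g).
Proof.
move=> x; apply: (@continuous_comp _ _ _ (fun x : G => (x, g))
  (fun z : G * G => z.1 + z.2)); last exact: add_continuous.
by apply: cvg_pair => /=; [exact: cvg_id|exact: cvg_cst].
Qed.

Lemma open_addr (g : G) (U : set G) : open U -> open [set x | U (x + g)].
Proof. by apply: open_comp => x _; exact: continuous_addr. Qed.

Lemma measurable_addr (g : G) (A : set G) :
  measurable (A : set (borel G)) ->
  measurable ([set x | A (x + g)] : set (borel G)).
Proof.
move=> mA.
have := @measurability _ _ (borel G) (borel G) setT (fun x : G => x + g) (@open G).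
move=> /(_ erefl) h.
rewrite -[X in measurable X]setTI; apply: h => // B [U oU <-].
rewrite setTI; apply: sub_sigma_algebra; exact: open_addr.
Qed.

Lemma translate_measure (R : realType) (mu : probability (borel G) R) g (A : set G) :
  haar_probability mu -> measurable (A : set (borel G)) ->
  mu [set x | A (x + g)] = mu A.
Proof.
move=> [inv _ _] mA; rewrite -(inv (- g) A mA); congr (mu _).
apply/seteqP; split=> x /=.
  by move=> Ax; exists (x + g) => //; rewrite addrC addrK.
by move=> [y Ay <-]; rewrite addrAC addNr add0r.
Qed.

(** Some open [U] around [0] has [U - U] disjoint from [E]. Finitely many translates of [U] cover
    [G]; a point is coloured by the first one containing it. *)
Lemma finite_borel_coloring (E : seq G) :
  compact [set: G] -> hausdorff_space G -> 0 \notin E ->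
  exists K : nat, exists l : G -> 'I_K,
    (forall j, measurable ([set x | l x = j] : set (borel G))) /\
    (forall x y, l x = l y -> x - y \notin E).
Proof.
move=> cG hG E0.
have [U [oU U0 UE]] : exists U : set G, [/\ open U, U 0 &
    forall x y, U x -> U y -> x - y \notin E].
  have cl : open [set z : G | z \notin E].
    have -> : [set z : G | z \notin E] = ~` [set` E].
      by apply/seteqP; split => z /=; [move/negP | move=> /negP].
    rewrite openC; move/hausdorff_accessible/accessible_finite_set_closed: hG.
    by apply; exact: finite_seq.
  have /(@sub_continuous G (0, 0)) [[P Q] /= [nP nQ] PQ] :
      nbhs ((0 : G) - 0) [set z : G | z \notin E].
    by apply: open_nbhs_nbhs; split => //=; rewrite subrr.
  have [U [[oU U0] UPQ]] : exists U, open_nbhs (0 : G) U /\ U `<=` P `&` Q.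
    have : nbhs (0 : G) (P `&` Q) by apply: filterI.
    by rewrite nbhsE => -[U ? ?]; exists U.
  exists U; split => // x y Ux Uy; apply: (PQ (x, y)); split => /=.
    by have [] := UPQ _ Ux.
  by have [] := UPQ _ Uy.
pose T : ptopologicalType := HB.pack G (isPointed.Build G 0).
have := cG; rewrite (@compact_cover T) => /(_ G setT (fun g => [set x | U (x + g)])).
case.
- by move=> g _; exact: open_addr.
- by move=> x _; exists (- x) => //=; rewrite subrr.
move=> D _ Dcov.
pose s := enum_fset D.
pose P (x : G) := [pred g | `[< U (x + g) >]].
have hs x : has (P x) s.
  by have [g gD /= Ug] := Dcov x I; apply/hasP; exists g => //; apply/asboolP.
have ls x : (find (P x) s < size s)%N by rewrite -has_find.
exists (size s), (fun x => Ordinal (ls x)); split.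
  move=> j.
  (* A colour class is one open translate minus the union of the earlier ones. *)
  have -> : [set x | Ordinal (ls x) = j] =
      [set x | U (x + nth 0 s j)] `&`
        ~` (\bigcup_(i in `I_j) [set x | U (x + nth 0 s i)]).
    apply/seteqP; split => x /=.
      move=> /(congr1 val)/= fj; split.
        by have := nth_find 0 (hs x); rewrite fj => /asboolP.
      move=> [i /= ij Ui].
      have := @before_find _ 0 (P x) s i; rewrite fj ij => /(_ isT).
      by move/asboolP.
    move=> [Uj nU]; apply/val_inj => /=; apply/eqP; rewrite eqn_leq.
    apply/andP; split; rewrite leqNgt; apply/negP => lt.
      have := @before_find _ 0 (P x) s j lt.
      by move/asboolP.
    apply: nU; exists (find (P x) s) => //=.
    by have := nth_find 0 (hs x) => /asboolP.
  have mU g : measurable ([set x | U (x + g)] : set (borel G)).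
    by apply: sub_sigma_algebra; exact: open_addr.
  apply: measurableI; first exact: mU.
  apply: measurableC; apply: fin_bigcup_measurable => // i _; exact: mU.
move=> x y /(congr1 val)/= fxy.
have /asboolP Ux := nth_find 0 (hs x).
have /asboolP Uy := nth_find 0 (hs y).
rewrite -fxy in Uy; have := UE _ _ Ux Uy.
by rewrite opprD addrACA subrr addr0.
Qed.

End translate.

(** * Closed walks from integer relations *)

Section walk.
Context (G : zmodType) (r : nat) (t : 'I_r -> G) (m : 'I_r -> int).

(** The vertices are the partial sums of the word [w] repeating each signed [t i] exactly [|m i|]
    times; the full sum is the relation, so the walk closes. *)
Lemma closed_walk : \sum_(i < r) t i *~ m i = 0 ->
  exists s : nat -> G, s (\sum_(i < r) `|m i|)%N = s 0%N /\
    forall j, (j < \sum_(i < r) `|m i|)%N ->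
      exists i, s j.+1 - s j = t i \/ s j - s j.+1 = t i.
Proof.
move=> tm0.
pose step i : G := if 0 <= m i then t i else - t i.
pose w := flatten [seq nseq `|m i|%N (step i) | i <- index_enum 'I_r].
have size_w : size w = (\sum_(i < r) `|m i|)%N.
  rewrite size_flatten /shape -map_comp sumnE big_map.
  by apply: eq_bigr => i _ /=; rewrite size_nseq.
exists (fun j => \sum_(x <- take j w) x); split.
  rewrite -size_w take_size take0 big_nil big_flatten/= big_map -[RHS]tm0.
  apply: eq_bigr => i _; rewrite big_nseq iter_addr_0 /step.
  have [m0|m0] := leP 0 (m i).
    by rewrite -[in RHS](gez0_abs m0).
  by rewrite -[in RHS](opprK (m i)) -(ltz0_abs m0) mulrNz mulNrn.
move=> j; rewrite -size_w => jw.
have /flatten_mapP[i _] : nth 0 w j \in w by exact: mem_nth.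
rewrite mem_nseq => /andP[_ /eqP wj]; exists i.
rewrite (take_nth 0)// -cats1 big_cat/= big_seq1 wj /step.
by case: ifP => _; [left; rewrite addrAC subrr add0r|right; rewrite opprB addrC subrK].
Qed.

End walk.

(** * The upper bound *)

Section upper_bound.
Context (R : realType) (G : topologicalZmodType) (mu : probability (borel G) R).
Context (r : nat) (t : 'I_r -> G) (m : 'I_r -> int).

Lemma motzkin_density_le : haar_probability mu ->
  \sum_(i < r) t i *~ m i = 0 ->
  let l1 := (\sum_(i < r) `|m i|)%N in (0 < l1)%N ->
  (motzkin_density mu (range t) <= ((l1./2)%:R / l1%:R : R)%:E)%E.
Proof.
move=> haar tm0 l1 l10; have [s [s_cl s_step]] := closed_walk tm0.
apply: ge_ereal_sup => _ [A [mA indep] <-].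
have mAs (j : 'I_l1) : measurable ([set x | A (x + s j)] : set (borel G)).
  exact: measurable_addr.
have := @sum_measure_le _ _ _ mu _ _ mAs l1./2.
under eq_bigr => j _ do rewrite (translate_measure _ haar mA).
have /fineK <- : mu A \is a fin_num by exact: fin_num_measure.
rewrite sumEFin sumr_const card_ord !lee_fin ler_pdivlMr ?ltr0n// mulr_natr.
(* It remains to count, for a fixed [x], the vertices [x + s j] lying in [A]. *)
apply => x.
apply: (@cyclic_independent_count _ (fun j => x \in [set x | A (x + s j)])).
  by rewrite s_cl.
move=> j jl; apply/negP => /andP[/set_mem/= Aj /set_mem/= Aj1].
have [i [eqi|eqi]] := s_step j jl.
  by apply: (indep _ _ Aj1 Aj); exists i => //; rewrite -eqi opprD addrACA subrr add0r.
by apply: (indep _ _ Aj Aj1); exists i => //; rewrite -eqi opprD addrACA subrr add0r.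
Qed.

End upper_bound.

(** * The lower bound: levels and cube images *)

Section lower_bound.
Context (R : realType) (G : topologicalZmodType) (mu : probability (borel G) R).
Hypotheses (cG : compact [set: G]) (hG : hausdorff_space G).
Context (r : nat) (t : 'I_r -> G) (m s : 'I_r -> int) (L : nat).
Hypothesis L_gt0 : (0 < L)%N.
Hypothesis s_unit : forall i, s i = 1 \/ s i = -1.
Hypothesis s_m : \sum_(i < r) s i * m i = L.

Definition int_comb (n : 'I_r -> int) : G := \sum_(i < r) t i *~ n i.
(** A height moving by exactly one along every generator, those with [m i = 0] included. It sends
    [m] to [L], so modulo [L] it depends only on [int_comb n]. *)
Definition level (n : 'I_r -> int) : int := \sum_(i < r) s i * n i.

Hypothesis ker_int_comb : forall n, int_comb n = 0 ->
  exists k : int, forall i, n i = k * m i.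

Lemma int_combB n n' : int_comb (fun i => n i - n' i) = int_comb n - int_comb n'.
Proof. by rewrite /int_comb -sumrB; apply: eq_bigr => i _; rewrite mulrzBr. Qed.

Lemma int_comb1 i : int_comb (fun j => (j == i)%:Z) = t i.
Proof.
rewrite /int_comb (bigD1 i)//= eqxx big1 ?addr0// => j ji.
by rewrite (negbTE ji).
Qed.

Lemma levelB n n' : level (fun i => n i - n' i) = level n - level n'.
Proof. by rewrite /level -sumrB; apply: eq_bigr => i _; rewrite mulrBr. Qed.

Lemma level1 i : level (fun j => (j == i)%:Z) = s i.
Proof.
rewrite /level (bigD1 i)//= eqxx mulr1 big1 ?addr0// => j ji.
by rewrite (negbTE ji) mulr0.
Qed.

Lemma level_ker n : int_comb n = 0 -> exists k : int, level n = k * L.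
Proof.
move=> /ker_int_comb[k nk]; exists k; rewrite -s_m mulr_sumr /level.
by apply: eq_bigr => i _; rewrite nk; ring.
Qed.

Local Notation box N := {ffun 'I_r -> 'I_(N.*2.+1)}.

Definition box_coord N (n : box N) (i : 'I_r) : int :=
  (n i : nat)%:Z - N%:Z.

(** Distinct cube points may have equal images; [undup] makes the size of the list the cardinality
    of the image. *)
Definition box_image N : seq G :=
  undup [seq int_comb (box_coord n) | n : box N].

Lemma box_imageP N g : reflect
  (exists2 n : 'I_r -> int, (forall i, `|n i| <= N%:Z) & g = int_comb n)
  (g \in box_image N).
Proof.
rewrite mem_undup; apply: (iffP mapP) => [[n _ ->]|[n nN ->]].
  exists (box_coord n) => // i.
  by rewrite /box_coord; move: (n i) => [a /= aN]; clear -aN; lia.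
pose n' := [ffun i => inord (absz (n i + N%:Z)) : 'I_(N.*2.+1)].
exists n'; first by rewrite mem_enum.
apply: eq_bigr => i _; congr (_ *~ _); rewrite /box_coord ffunE.
by have := nN i => ?; rewrite inordK; lia.
Qed.

Lemma box_image_sub N : {subset box_image N <= box_image N.+1}.
Proof.
move=> g /box_imageP[n nN ->]; apply/box_imageP; exists n => // i.
by have := nN i; lia.
Qed.

Lemma box_image_addl N i g : g \in box_image N -> t i + g \in box_image N.+1.
Proof.
move=> /box_imageP[n nN ->]; apply/box_imageP.
(* The sum is written as a difference so that [int_combB] applies. *)
exists (fun j => (j == i)%:Z - (0 - n j)) => [j|].
  by have := nN j; case: eqP; lia.
rewrite int_combB int_comb1; congr (_ + _); rewrite /int_comb -sumrN.
by apply: eq_bigr => j _; rewrite sub0r mulrNz opprK.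
Qed.

Lemma box_image_subl N i g : g \in box_image N -> g - t i \in box_image N.+1.
Proof.
move=> /box_imageP[n nN ->]; apply/box_imageP.
exists (fun j => n j - (j == i)%:Z) => [j|]; last by rewrite int_combB int_comb1.
by have := nN j; case: eqP; lia.
Qed.

Lemma size_box_image N : (size (box_image N) <= (N.*2.+1) ^ r)%N.
Proof.
rewrite (leq_trans (size_undup _))// size_map -cardE card_ffun !card_ord//.
Qed.

Lemma box_image0 N : (0 < size (box_image N))%N.
Proof.
rewrite lt0n size_eq0; apply/eqP => E.
have : int_comb (fun=> 0) \in box_image N by apply/box_imageP; exists (fun=> 0).
by rewrite E.
Qed.

(** * The lower bound: selection at a fixed window size *)

Section layer.
Variables (N K : nat) (l : G -> 'I_K).
Hypothesis ml : forall j, measurable ([set x | l x = j] : set (borel G)).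
Hypothesis l_inj : forall x g g', g \in box_image N.+1 -> g' \in box_image N.+1 ->
  l (x + g) = l (x + g') -> g = g'.

(** The minimum over the window [N.+1] must be attained in the window [N]; this margin of one step
    keeps the minimiser visible from neighbouring points. The rotation [c] of the cycle is averaged
    out later. *)
Definition argmin_set (p : 'S_K) (c : nat) : set G :=
  [set x | exists n : box N,
    (forall g, g \in box_image N.+1 ->
       (p (l (x + int_comb (box_coord n))%R) <= p (l (x + g)%R))%N) /\
    alt_residue L (level (box_coord n) + c)].

Lemma mem_box_image (n : box N) : int_comb (box_coord n) \in box_image N.
Proof. by rewrite mem_undup; apply/mapP; exists n; rewrite ?mem_enum. Qed.

(** Membership depends only on the colours of finitely many translates of [x]. *)
Lemma measurable_argmin_set p c : measurable (argmin_set p c : set (borel G)).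
Proof.
pose W (j j' : 'I_K) g g' : set (borel G) :=
  [set x | l (x + g) = j] `&` [set x | l (x + g') = j'].
have mW j j' g g' : measurable (W j j' g g').
  by apply: measurableI; exact: (measurable_addr _ (ml _)).
have -> : argmin_set p c =
    \bigcup_(n in [set n : box N | alt_residue L (level (box_coord n) + c)])
      \bigcap_(g in [set` box_image N.+1])
        \bigcup_(jj in [set jj : 'I_K * 'I_K | (p jj.1 <= p jj.2)%N])
          W jj.1 jj.2 (int_comb (box_coord n)) g.
  apply/seteqP; split => x.
    move=> [n [nmin res]]; exists n => // g /= gF.
    exists (l (x + int_comb (box_coord n)), l (x + g)) => //=.
    exact: nmin.
  move=> [n /= res nmin]; exists n; split => // g gF.
  by have [[j j'] /= jj' [/= -> ->]] := nmin g gF.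
apply: fin_bigcup_measurable; first exact: finite_finset.
move=> n _; apply: fin_bigcap_measurable; first exact: finite_seq.
move=> g _; apply: fin_bigcup_measurable; first exact: finite_finset.
by move=> jj _.
Qed.

(* The minimisers seen from [a] and from [b = a - t i] lie in each other's
   window, hence coincide. *)
Lemma argmin_set_indep p c a b :
  argmin_set p c a -> argmin_set p c b -> ~ range t (a - b).
Proof.
move=> [n [amin ares]] [n' [bmin bres]] [i _ ti].
have aE : a = b + t i by rewrite ti addrC subrK.
have eqn : t i + int_comb (box_coord n) = int_comb (box_coord n').
  have F1 : t i + int_comb (box_coord n) \in box_image N.+1.
    exact: box_image_addl (mem_box_image n).
  apply: (@l_inj b) => //; first exact/box_image_sub/mem_box_image.
  apply/(@perm_inj _ p)/val_inj/eqP; rewrite eqn_leq bmin// andbT.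
  have := amin _ (box_image_subl i (mem_box_image n')).
  by rewrite aE -!addrA [t i + (_ - _)]addrC subrK.
(* Both displacements reach the same point, so modulo [L] their levels differ by [s i], a single
   step on the cycle. *)
have [|k] := @level_ker (fun j => (box_coord n' j - box_coord n j) - (j == i)%:Z).
  by rewrite int_combB (int_combB (box_coord n')) int_comb1 -eqn addrK subrr.
rewrite levelB (levelB (box_coord n')) level1 => kE.
have n'E : level (box_coord n') + c = (level (box_coord n) + c + s i) + k * L.
  by rewrite -kE; ring.
move: bres; rewrite n'E alt_residueD.
case: (s_unit i) => ->; first by apply/negP/alt_residue_indep.
move=> /(alt_residue_indep L_gt0); rewrite subrK => /negP; exact.
Qed.

Definition window (M : nat) (x : G) : {set 'I_K} :=
  [set j in [seq l (x + g) | g <- box_image M]]%SET.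

Lemma window_sub x : window N x \subset window N.+1 x.
Proof.
apply/fintype.subsetP => j; rewrite !inE => /mapP[g gF ->].
by apply: map_f; exact: box_image_sub.
Qed.

Lemma card_window M x : {subset box_image M <= box_image N.+1} ->
  #|window M x| = size (box_image M).
Proof.
move=> MN; rewrite cardsE (card_uniqP _) ?size_map//.
rewrite map_inj_in_uniq ?undup_uniq// => g g' gF gF'.
by apply: l_inj; exact: MN.
Qed.

Definition good_perms (x : G) : {set 'S_K} :=
  [set p : 'S_K | [exists a in window N x,
    [forall b in window N.+1 x, (p a <= p b)%N]]]%SET.

Lemma card_good_perms x :
  (#|good_perms x| * size (box_image N.+1) = size (box_image N) * K`!)%N.
Proof.
have := card_perm_argmin (window_sub x).
by rewrite !card_window//; exact: box_image_sub.
Qed.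

(** Each good permutation keeps [x] for at least [L./2] of the rotations. The number of good
    permutations is the same at every point, so it is taken at [0] to give a constant bound to
    integrate. *)
Lemma argmin_set_count x :
  (L./2 * #|good_perms (0 : G)%R| <=
   \sum_(pc : 'S_K * 'I_L) (x \in argmin_set pc.1 pc.2))%N.
Proof.
have -> : #|good_perms (0 : G)%R| = #|good_perms x|.
  by apply/eqP; rewrite -(eqn_pmul2r (box_image0 N.+1)) !card_good_perms.
rewrite -(pair_bigA _ (fun p (c : 'I_L) => (x \in argmin_set p c) : nat))/=.
rewrite mulnC -sum1dep_card big_distrl/= big_mkcond/=.
apply: leq_sum => p _; case: ifP => // /exists_inP[a].
rewrite inE => /mapP[g gF ->] /forall_inP amin; rewrite mul1n.
have [n _ gE] := mapP (etrans (esym (mem_undup _ _)) gF).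
rewrite -(sum_alt_residue (level (box_coord n)) L_gt0).
apply: leq_sum => c _.
have [res|//] := boolP (alt_residue _ _).
rewrite (_ : (x \in _) = true)//; apply/mem_set; exists n; split => // g' g'F.
by rewrite -gE; apply: amin; rewrite inE; exact: map_f.
Qed.

End layer.

Lemma motzkin_density_ge :
  ((L./2%:R / L%:R : R)%:E <= motzkin_density mu (range t))%E.
Proof.
set Md := motzkin_density _ _.
have Md0 : (0 <= Md)%E.
  apply: ereal_sup_ubound; exists set0; rewrite ?measure0//.
have Md1 : (Md <= 1)%E.
  apply: ge_ereal_sup => _ [A [mA _] <-]; exact: probability_le1.
have /fineK MdE : Md \is a fin_num.
  by rewrite fin_numElt (lt_le_trans _ Md0) ?ltNyr// (le_lt_trans Md1) ?ltry.
rewrite -MdE lee_fin ler_pdivrMr ?ltr0n//.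
(* With [a = L./2] and [b = fine Md * L], this absorbs the loss from points whose minimiser falls
   outside the smaller window. *)
apply: (@poly_growth_ratio R (fun N => size (box_image N)) r).
- exact: box_image0.
- exact: size_box_image.
- by rewrite mulr_ge0// fine_ge0.
move=> N.
(* Avoiding the nonzero differences of [box_image N.+1] makes the colouring injective on each of its
   translates. *)
pose E := [seq g - g' | g <- box_image N.+1, g' <- box_image N.+1].
have [|K [l [ml lE]]] := @finite_borel_coloring G [seq g <- E | g != 0] cG hG.
  by rewrite mem_filter eqxx.
have l_inj x g g' : g \in box_image N.+1 -> g' \in box_image N.+1 ->
    l (x + g) = l (x + g') -> g = g'.
  move=> gF g'F /lE; rewrite opprD addrACA subrr add0r mem_filter.
  have -> : g - g' \in E by apply/allpairsP; exists (g, g').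
  by rewrite andbT negbK subr_eq0 => /eqP.
have := @sum_measure_ge _ _ _ mu _ (fun pc : 'S_K * 'I_L => argmin_set N l pc.1 pc.2)
  (fun pc => measurable_argmin_set N ml _ _) _ (argmin_set_count l_inj).
set k := #|_| => ge.
have kE : (k * size (box_image N.+1) = size (box_image N) * K`!)%N.
  exact: card_good_perms.
have : (((L./2 * k)%N%:R : R)%:E <= (\sum_(pc : 'S_K * 'I_L) fine Md)%R%:E)%E.
  apply: (le_trans ge); rewrite -sumEFin; apply: lee_sum => pc _.
  rewrite MdE; apply: ereal_sup_ubound; exists (argmin_set N l pc.1 pc.2) => //.
  split; first exact: measurable_argmin_set.
  exact: argmin_set_indep.
rewrite lee_fin sumr_const card_prod card_ord card_Sn -[leRHS]mulr_natr => h.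
have K0 : (0 : R) < K`!%:R by rewrite ltr0n fact_gt0.
rewrite -(ler_pM2r K0) -[leLHS]mulrA -natrM -kE natrM mulrA -natrM.
apply: (le_trans (ler_wpM2r _ h)) => //.
by rewrite natrM le_eqVlt; apply/orP; left; apply/eqP; ring.
Qed.

End lower_bound.

Theorem theorem1p2 (R : realType) (G : topologicalZmodType)
    (mu : probability (borel G) R)
    (Gcompact : compact [set: G]) (Ghausdorff : hausdorff_space G)
    (muHaar : haar_probability mu)
    (r : nat) (t : 'I_r -> G) (t_neq0 : forall i, t i != 0)
    (m : 'I_r -> int) (m_neq0 : exists i, m i != 0)
    (m_gen : forall n : 'I_r -> int,
        (\sum_(i < r) t i *~ n i = 0) <-> (exists k : int, forall i, n i = k * m i)) :
  let l1 := (\sum_(i < r) `|m i|)%N in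
  motzkin_density mu (range t) = ((l1./2)%:R / l1%:R : R)%:E.
Proof.
move=> l1; have [i0 mi0] := m_neq0.
have l1_gt0 : (0 < l1)%N.
  by rewrite /l1 (bigD1 i0)//= addn_gt0 absz_gt0 mi0.
apply/eqP; rewrite eq_le; apply/andP; split.
  apply: motzkin_density_le => //; apply/m_gen.
  by exists 1 => i; rewrite mul1r.
(* The sign at [m i = 0] is arbitrary but must be a unit, so that each [t i] changes the level by
   one. *)
pose s i : int := if 0 <= m i then 1 else -1.
apply: (@motzkin_density_ge R G mu Gcompact Ghausdorff r t m s) => //.
- by move=> i; rewrite /s; case: ifP; [left|right].
- rewrite /l1 (big_morph Posz PoszD (erefl _)); apply: eq_bigr => i _.
  by rewrite /s; case: ifP; lia.
- by move=> n /m_gen.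
Qed.
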